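(* Suppose $f:\mathcal M\to\mathbb{R}^n$ is $C^1$-continuous over $\mathcal M$. Then for every $\mathbf{x}\in\mathcal M_{ijk}$, $$\Big|\,\|\nabla_{\mathcal M}f(\mathbf{x})\|_F^2-\|f_{ijk}b_{ijk}^\top\|_F^2\,\Big|\le\psi_f^2(\mathbf{x})+2\|f_{ijk}b_{ijk}^\top\|_F\,\psi_f(\mathbf{x}),$$ where $$\psi_f(\mathbf{x})=\|h_{ijk}(\mathbf{x})b_{ijk}^\top\|_F+\|\nabla_{\mathcal M}f(\mathbf{x})\|_F\,\|\mathbf{n}_{ijk}^\top Q(\mathbf{x})\|_2^2.$$
   Context: $\mathcal M$ is a smooth simple surface embedded in $\mathbb{R}^m$ with $m\ge2$, parameterized as $\mathcal M=\{\mathbf{x}(\omega):\omega\in\Omega\}$, $\Omega\subset\mathbb{R}^2$, with $\nabla\mathbf{x}(\omega)\in\mathbb{R}^{m\times2}$ the matrix of partial derivatives, of full column rank. $\Omega_{ijk}\subset\Omega$ is a nondegenerate (closed, solid) triangle with vertices $\omega_i,\omega_j,\omega_k$; $\mathcal M_{ijk}=\{\mathbf{x}(\omega):\omega\in\Omega_{ijk}\}$; $v_\ell=\mathbf{x}(\omega_\ell)$, $\ell=i,j,k$; $V_{ijk}$ is the triangle with vertices $v_i,v_j,v_k$, assumed nondegenerate, with area $A_{ijk}$; $v_{ij}=v_i-v_j$, $v_{jk}=v_j-v_k$, $v_{ki}=v_k-v_i$. $\mathbf{n}_{ijk}$ is the unit normal vector of the plane of $V_{ijk}$ in a right-hand system,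 with $v_{ij}\times v_{jk}=2A_{ijk}\mathbf{n}_{ijk}$, where $\times$ is the exterior (cross) product. Set $b_i=\frac{v_{jk}\times\mathbf{n}_{ijk}}{2A_{ijk}}$, $b_j=\frac{v_{ki}\times\mathbf{n}_{ijk}}{2A_{ijk}}$, $b_k=\frac{v_{ij}\times\mathbf{n}_{ijk}}{2A_{ijk}}$ and $b_{ijk}=[b_i,b_j,b_k]\in\mathbb{R}^{m\times3}$; thus the barycentric coordinates of a point $p$ of the plane of $V_{ijk}$ are $\langle b_i,p-v_j\rangle$, $\langle b_j,p-v_k\rangle$, $\langle b_k,p-v_i\rangle$, and $b_{ijk}^\top\mathbf{n}_{ijk}=0$. $Q(\mathbf{x})=\nabla\mathbf{x}(\nabla\mathbf{x}^\top\nabla\mathbf{x})^{-1/2}$ is an orthonormal basis matrix of the tangent space of $\mathcal M$ at $\mathbf{x}$. The tangential gradient is $\nabla_{\mathcal M}f(\mathbf{x})=\nabla(f\circ\mathbf{x})\,(\nabla\mathbf{x}^\top\nabla\mathbf{x})^{-1}\nabla\mathbf{x}^\top\in\mathbb{R}^{n\times m}$, where $\nabla(f\circ\mathbf{x})\in\mathbb{R}^{n\times2}$ is the Jacobian of $\omega\mapsto f(\mathbf{x}(\omega))$. Further, $f_{ijk}=[f(v_i),f(v_j),f(v_k)]\in\mathbb{R}^{n\times3}$ and $h_{ijk}(\mathbf{x})=[h_i(\mathbf{x}),h_j(\mathbf{x}),h_k(\mathbf{x})]$ with $h_\ell(\mathbf{x})=f(v_\ell)-f(\mathbf{x})+\nabla_{\mathcal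 M}f(\mathbf{x})(\mathbf{x}-v_\ell)$. $\|\cdot\|_F$ is the Frobenius norm, $\|\cdot\|_2$ the Euclidean norm. *)

(* Defs.v *)
(* Points of R^p are column vectors, and Jacobians are p x 2 matrices. *)
From HB Require Import structures.
From mathcomp Require Import all_boot all_order all_algebra.
From mathcomp Require Import ring lra.
From mathcomp Require Import all_classical all_reals all_analysis.

Set Implicit Arguments.
Unset Strict Implicit.
Unset Printing Implicit Defensive.

Import Order.TTheory GRing.Theory Num.Theory.
Import numFieldNormedType.Exports.

Local Open Scope classical_set_scope.
Local Open Scope ring_scope.

(* Frobenius norm; on a column or a row it is the Euclidean norm.  (The norm
   `|A| of MathComp-Analysis on matrices is the max norm.) *)
Definition frob (R : realType) (p q : nat) (A : 'M[R]_(p, q)) : R :=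
  Num.sqrt (\sum_(i < p) \sum_(j < q) A i j ^+ 2).

Definition col3 (R : realType) (p : nat) (a b c : 'cV[R]_p) : 'M[R]_(p, 3) :=
  row_mx a (row_mx b c).

(* The derivative at w is taken relative to Omega, so that Omega need not be
   open; see [is_jac_interior] for interior points. *)
Definition is_jac (R : realType) (p : nat) (Omega : set 'cV[R]_2)
    (g : 'cV[R]_2 -> 'cV[R]_p) (w : 'cV[R]_2) (J : 'M[R]_(p, 2)) : Prop :=
  forall w' : 'cV[R]_2,
    g w' = g w + J *m (w' - w)
           +o_(w' \near within Omega (nbhs w)) (w' - w).

Definition jac (R : realType) (p : nat) (Omega : set 'cV[R]_2)
    (g : 'cV[R]_2 -> 'cV[R]_p) (w : 'cV[R]_2) : 'M[R]_(p, 2) :=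
  xget 0 [set J | is_jac Omega g w J].

Definition C1_on (R : realType) (p : nat) (Omega : set 'cV[R]_2)
    (g : 'cV[R]_2 -> 'cV[R]_p) : Prop :=
  exists J : 'cV[R]_2 -> 'M[R]_(p, 2),
    (forall w, Omega w -> is_jac Omega g w (J w)) /\
    {within Omega, continuous J}.

Definition smooth_simple_surface (R : realType) (m : nat)
    (Omega : set 'cV[R]_2) (x : 'cV[R]_2 -> 'cV[R]_m) : Prop :=
  [/\ C1_on Omega x,
      set_inj Omega x &
      forall w, Omega w -> \rank (jac Omega x w) = 2%N].

Definition triangle (R : realType) (p : nat) (a b c : 'cV[R]_p) :
    set 'cV[R]_p :=
  [set y | exists s t u : R,
     [/\ 0 <= s, 0 <= t, 0 <= u, s + t + u = 1 &
         y = s *: a + t *: b + u *: c]].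

Definition nondegenerate_triangle (R : realType) (p : nat) (a b c : 'cV[R]_p) : Prop :=
  \rank (row_mx (a - b) (b - c)) = 2%N.

(* Half the area of the parallelogram on a - b and b - c (Gram determinant). *)
Definition area (R : realType) (p : nat) (a b c : 'cV[R]_p) : R :=
  let E := row_mx (a - b) (b - c) in Num.sqrt (\det (E^T *m E)) / 2.

(* Cross products in R^m, for every m, through the exterior algebra.  A
   bivector is a skew-symmetric matrix, u /\ v being u v^T - v u^T, and the
   unit normal of a plane is the unit bivector
   (v_ij /\ v_jk) / (2 A).  For m = 3 a bivector N is the vector [hodge3 N], and
   the lemmas [hodge3_ext_prod], [cross_bivecE3] and [normal_normE3] below
   say that the products used here are then u x v, w x n and ||n^T Q||_2. *)
Definition ext_prod (R : realType) (m : nat) (u v : 'cV[R]_m) : 'M[R]_m :=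
  u *m v^T - v *m u^T.

(* The contraction of w with N, written w x n: for N = u /\ v it is
   <v, w> u - <u, w> v, that is w x (u x v) when m = 3. *)
Definition cross_bivec (R : realType) (m : nat) (w : 'cV[R]_m)
    (N : 'M[R]_m) : 'cV[R]_m :=
  N *m w.

(* Coordinates of the trivector N /\ w; it is zero iff w is in the plane of the
   (simple, nonzero) bivector N, and it is <n, w> when m = 3. *)
Definition ext_wedge (R : realType) (m : nat) (N : 'M[R]_m) (w : 'cV[R]_m) :
    'I_m -> 'I_m -> 'I_m -> R :=
  fun a b c => N a b * w c 0 + N b c * w a 0 + N c a * w b 0.

(* Euclidean norm in the basis e_a /\ e_b /\ e_c, a < b < c. *)
Definition trivec_norm (R : realType) (m : nat)
    (t : 'I_m -> 'I_m -> 'I_m -> R) : R :=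
  Num.sqrt (\sum_(a < m) \sum_(b < m | (a < b)%N) \sum_(c < m | (b < c)%N)
              t a b c ^+ 2).

(* ||n^T Q||_2, the operator norm of the map sending y to <n, Q y>. *)
Definition normal_norm (R : realType) (m : nat) (N : 'M[R]_m)
    (Q : 'M[R]_(m, 2)) : R :=
  sup [set trivec_norm (ext_wedge N (Q *m y)) | y in [set y : 'cV[R]_2 | frob y = 1]].

Definition face_normal (R : realType) (m : nat) (vi vj vk : 'cV[R]_m) :
    'M[R]_m :=
  (2 * area vi vj vk)^-1 *: ext_prod (vi - vj) (vj - vk).

(* [b_i, b_j, b_k] *)
Definition bary_mx (R : realType) (m : nat) (vi vj vk : 'cV[R]_m) :
    'M[R]_(m, 3) :=
  let N := face_normal vi vj vk in
  let A2 := 2 * area vi vj vk in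
  col3 (A2^-1 *: cross_bivec (vj - vk) N)
       (A2^-1 *: cross_bivec (vk - vi) N)
       (A2^-1 *: cross_bivec (vi - vj) N).

Definition posdef (R : realType) (p : nat) (S : 'M[R]_p) : Prop :=
  S^T = S /\ forall y : 'cV[R]_p, y != 0 -> 0 < (y^T *m S *m y) 0 0.

(* G^(-1/2), for a positive definite G. *)
Definition inv_sqrt_mx (R : realType) (p : nat) (G : 'M[R]_p) : 'M[R]_p :=
  xget 0 [set S | posdef S /\ S *m S = invmx G].

Definition tangent_basis (R : realType) (m : nat) (Omega : set 'cV[R]_2)
    (x : 'cV[R]_2 -> 'cV[R]_m) (w : 'cV[R]_2) : 'M[R]_(m, 2) :=
  let J := jac Omega x w in J *m inv_sqrt_mx (J^T *m J).

(* The tangential gradient at the point x(w). *)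
Definition tgrad (R : realType) (m n : nat) (Omega : set 'cV[R]_2)
    (x : 'cV[R]_2 -> 'cV[R]_m) (f : 'cV[R]_m -> 'cV[R]_n) (w : 'cV[R]_2) :
    'M[R]_(n, m) :=
  let J := jac Omega x w in
  jac Omega (f \o x) w *m invmx (J^T *m J) *m J^T.

(* h_l at the point x(w), for the vertex v = v_l. *)
Definition tangent_remainder (R : realType) (m n : nat) (Omega : set 'cV[R]_2)
    (x : 'cV[R]_2 -> 'cV[R]_m) (f : 'cV[R]_m -> 'cV[R]_n) (w : 'cV[R]_2)
    (v : 'cV[R]_m) : 'cV[R]_n :=
  f v - f (x w) + tgrad Omega x f w *m (x w - v).

Definition psi (R : realType) (m n : nat) (Omega : set 'cV[R]_2)
    (x : 'cV[R]_2 -> 'cV[R]_m) (f : 'cV[R]_m -> 'cV[R]_n)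
    (vi vj vk : 'cV[R]_m) (w : 'cV[R]_2) : R :=
  let h := tangent_remainder Omega x f w in
  frob (col3 (h vi) (h vj) (h vk) *m (bary_mx vi vj vk)^T)
  + frob (tgrad Omega x f w)
    * normal_norm (face_normal vi vj vk) (tangent_basis Omega x w) ^+ 2.

Lemma mulmx_continuous (R : realType) (p : nat) (J : 'M[R]_(p, 2)) :
  continuous (mulmx J : 'cV[R]_2 -> 'cV[R]_p).
Proof.
apply: bounded_linear_continuous; apply/linear_boundedP.
exists (\sum_i \sum_j `|J i j|); split; first exact: num_real.
move=> c /ltW lec y.
have c0 : 0 <= c.
  by apply: le_trans lec; apply: sumr_ge0 => i _; apply: sumr_ge0.
rewrite [X in X <= _]mx_normrE; apply/bigmax_leP; split => [|[i j] _ /=].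
  by rewrite mulr_ge0.
have yle k : `|y k 0| <= `|y|.
  by rewrite [leRHS]mx_normrE; apply: (le_bigmax _ _ (k, 0)).
rewrite (ord1 j) mxE (le_trans (ler_norm_sum _ _ _))//.
apply: (@le_trans _ _ (\sum_k `|J i k| * `|y|)).
  by apply: ler_sum => k _; rewrite normrM ler_wpM2l.
rewrite -mulr_suml ler_wpM2r// (le_trans _ lec)// (bigD1 i)//= lerDl.
by apply: sumr_ge0 => ? _; apply: sumr_ge0.
Qed.

Lemma is_jacP (R : realType) (p : nat) (Omega : set 'cV[R]_2)
    (g : 'cV[R]_2 -> 'cV[R]_p) (w : 'cV[R]_2) (J : 'M[R]_(p, 2)) :
  is_jac Omega g w J <->
  forall e : R, 0 < e -> \forall w' \near within Omega (nbhs w),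
    `|g w' - (g w + J *m (w' - w))| <= e * `|w' - w|.
Proof.
rewrite -(@eqaddoP R _ 'cV[R]_p 'cV[R]_2
  (within_filter_on Omega (nbhs_filter_on w)) g
  (fun w' => g w + J *m (w' - w)) (fun w' => w' - w)).
by rewrite funeqE.
Qed.

Lemma is_jac_interior (R : realType) (p : nat) (Omega : set 'cV[R]_2)
    (g : 'cV[R]_2 -> 'cV[R]_p) (w : 'cV[R]_2) (J : 'M[R]_(p, 2)) :
  Omega° w ->
  is_jac Omega g w J <-> differentiable g w /\ 'd g w = mulmx J :> (_ -> _).
Proof.
move=> Ow; pose V : normedModType R := 'cV[R]_2.
pose W : normedModType R := 'cV[R]_p.
pose G : V -> W := g; pose L : {linear V -> W} := mulmx J.
have cJ : continuous L by exact: mulmx_continuous.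
have E : is_jac Omega g w J <->
    G \o shift (w : V) = cst (G w) + (L : V -> W) +o_ (0 : V) id.
  have sh (e : R) : (\forall w' \near within Omega (nbhs w),
      `|g w' - (g w + J *m (w' - w))| <= e * `|w' - w|) =
    (\forall h \near (0 : V),
      `|(G \o shift (w : V) - (cst (G w) + (L : V -> W))) h| <= e * `|h|).
    rewrite within_interior// [LHS](@near_shift R V 0 w) /= subr0.
    by apply/propext; split; apply: filterS => h /=; rewrite addrK.
  split => [/is_jacP|/eqaddoP] H; [apply/eqaddoP|apply/is_jacP] => e e0.
    by have := H e e0; rewrite sh.
  by rewrite sh; exact: H e e0.
rewrite E; split=> [gE|[dg dE]].
  have dE := diff_unique cJ gE.
  by split=> //; apply/diff_locallyP; rewrite dE.
by have := diff_locally dg; rewrite dE.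
Qed.

(* The classical vector product of R^3, and the vector of a bivector. *)
Definition crossmul (R : realType) (u v : 'cV[R]_3) : 'cV[R]_3 :=
  \col_(a < 3) (u (a + 1) 0 * v (a + 2) 0 - u (a + 2) 0 * v (a + 1) 0).

Definition hodge3 (R : realType) (N : 'M[R]_3) : 'cV[R]_3 :=
  \col_(a < 3) N (a + 1) (a + 2).

Lemma hodge3_ext_prod (R : realType) (u v : 'cV[R]_3) :
  hodge3 (ext_prod u v) = crossmul u v.
Proof.
apply/colP => a; rewrite !mxE !big_ord1 !mxE; ring.
Qed.

Lemma sum_ord3 (R : realType) (F : 'I_3 -> R) :
  \sum_(i < 3) F i = F 0 + F 1 + F 2.
Proof.
rewrite !big_ord_recl big_ord0 addr0 -addrA.
by congr (F _ + (F _ + F _)); apply: val_inj.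
Qed.

Lemma skew3 (R : realType) (N : 'M[R]_3) : N^T = - N ->
  [/\ forall i, N i i = 0, N 1 0 = - N 0 1, N 2 1 = - N 1 2 & N 0 2 = - N 2 0].
Proof.
move=> NT; have Nij i j : N i j = - N j i.
  by rewrite -[N in LHS]trmxK mxE NT mxE.
by split=> // i; have := Nij i i; lra.
Qed.

Lemma ord3E : ((1 + 1 = 2 :> 'I_3)%R * (1 + 2 = 0 :> 'I_3)%R *
  (2 + 1 = 0 :> 'I_3)%R * (2 + 2 = 1 :> 'I_3)%R)%type.
Proof. by do !split; apply: val_inj. Qed.

Lemma cross_bivecE3 (R : realType) (N : 'M[R]_3) (w : 'cV[R]_3) :
  N^T = - N -> cross_bivec w N = crossmul w (hodge3 N).
Proof.
move=> /skew3[N0 N10 N21 N02].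
have E a : a \in [:: 0; 1; 2 : 'I_3].
  by case: a => -[|[|[|//]]] ?; rewrite !inE.
apply/colP => a; have := E a; rewrite !inE !mxE sum_ord3.
by move=> /or3P[] /eqP ->; rewrite ?add0r !ord3E ?add0r ?ord3E N0 ?N10 ?N21 ?N02;
  ring.
Qed.

Lemma trivec_norm_wedge3 (R : realType) (N : 'M[R]_3) (w : 'cV[R]_3) :
  trivec_norm (ext_wedge N w) = `|((hodge3 N)^T *m w) 0 0|.
Proof.
rewrite /trivec_norm -sqrtr_sqr; congr Num.sqrt.
rewrite sum_ord3.
rewrite ![\sum_(b < 3 | _) _]big_mkcond !sum_ord3 /=.
rewrite ![\sum_(b < 3 | _) _]big_mkcond !sum_ord3 /=.
rewrite ![\sum_(c < 3 | ((1 %% 3 + 1 %% 3) %% 3 < c)%N) _]big_mkcond.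
rewrite !sum_ord3 /= /ext_wedge !mxE sum_ord3 !mxE ?add0r !ord3E.
ring.
Qed.

Lemma normal_normE3 (R : realType) (N : 'M[R]_3) (Q : 'M[R]_(3, 2)) :
  normal_norm N Q = frob ((hodge3 N)^T *m Q).
Proof.
rewrite /normal_norm; set r := (hodge3 N)^T *m Q.
have sum2 (F : 'I_2 -> R) : \sum_i F i = F 0 + F 1.
  by rewrite big_ord_recl big_ord1; congr (_ + F _); apply: val_inj.
have tE y : trivec_norm (ext_wedge N (Q *m y)) = `|r 0 0 * y 0 0 + r 0 1 * y 1 0|.
  by rewrite trivec_norm_wedge3 mulmxA -/r mxE sum2.
clearbody r.
have fE (y : 'cV[R]_2) : frob y = Num.sqrt (y 0 0 ^+ 2 + y 1 0 ^+ 2).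
  by rewrite /frob sum2 !big_ord1.
have rE : frob r = Num.sqrt (r 0 0 ^+ 2 + r 0 1 ^+ 2).
  by rewrite /frob big_ord1 sum2.
set a := r 0 0 in tE rE; set b := r 0 1 in tE rE.
have ub (y : 'cV[R]_2) : frob y = 1 -> trivec_norm (ext_wedge N (Q *m y)) <= frob r.
  rewrite fE => y1; rewrite tE rE -sqrtr_sqr; apply: ler_wsqrtr.
  have : y 0 0 ^+ 2 + y 1 0 ^+ 2 = 1.
    by rewrite -[LHS]sqr_sqrtr ?y1 ?expr1n// addr_ge0 ?sqr_ge0.
  move: (y 0 0) (y 1 0) => s t st; have := sqr_ge0 (a * t - b * s); nra.
have [y y1 yr] : exists2 y : 'cV[R]_2, frob y = 1 &
    trivec_norm (ext_wedge N (Q *m y)) = frob r.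
  have [r0|r0] := eqVneq (frob r) 0.
    exists (delta_mx 0 0).
      by rewrite fE !mxE /= expr1n expr0n addr0 sqrtr1.
    apply/eqP; rewrite eq_le ub/=; last first.
      by rewrite fE !mxE /= expr1n expr0n addr0 sqrtr1.
    by rewrite r0 tE.
  exists ((frob r)^-1 *: r^T).
    rewrite fE !mxE -/a -/b !exprMn -mulrDr sqrtrM ?sqr_ge0// -rE sqrtr_sqr.
    by rewrite ger0_norm ?mulVf// invr_ge0 sqrtr_ge0.
  rewrite tE !mxE -/a -/b.
  have r2 : frob r ^+ 2 = a ^+ 2 + b ^+ 2.
    by rewrite rE sqr_sqrtr// addr_ge0 ?sqr_ge0.
  have -> : a * ((frob r)^-1 * a) + b * ((frob r)^-1 * b) = frob r.
    transitivity ((frob r)^-1 * frob r ^+ 2); first by rewrite r2; ring.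
    by rewrite expr2 mulKf.
  by rewrite ger0_norm// sqrtr_ge0.
have hub : ubound [set trivec_norm (ext_wedge N (Q *m y)) |
    y in [set y : 'cV[R]_2 | frob y = 1]] (frob r).
  by move=> _ [z /= z1 <-]; exact: ub.
apply/eqP; rewrite eq_le; apply/andP; split.
  by apply: ge_sup => //; exists (frob r), y.
by apply: ub_le_sup; [exists (frob r)|exists y].
Qed.

(* Main.v *)
Require Import Defs.
From HB Require Import structures.
From mathcomp Require Import all_boot all_order all_algebra.
From mathcomp Require Import ring lra zify.
From mathcomp Require Import all_classical all_reals all_analysis.

Set Implicit Arguments.
Unset Strict Implicit.
Unset Printing Implicit Defensive.

Import Order.TTheory GRing.Theory Num.Theory.
Import numFieldNormedType.Exports.

Local Open Scope classical_set_scope.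
Local Open Scope ring_scope.

(** Write G for the tangential gradient at x, N for the unit bivector of the
    plane of the three vertices, Q for the orthonormal tangent basis and b for
    the matrix of the b_l.

    The b_l sum to zero and P = sum_l v_l b_l^T = N N^T is the orthogonal
    projection onto the plane of the vertices ([bary_mx_reconstruction]).  Since
    f(v_l) = h_l + (f(x) - G x) + G v_l, this gives F b^T = h b^T + G P.  Hence
    | |F b^T| - |G P| | <= |h b^T| in Frobenius norm, and it remains to compare
    |G P| with |G|.

    The rows of G are tangent vectors, that is G = G Q Q^T, because Q Q^T is the
    projection onto the tangent space ([orthonormalize]).  For a vector w, the
    trivector N /\ w measures what P removes from w:
    |N /\ w|^2 = |w|^2 - |N w|^2 ([sqr_trivec_norm_wedge]), where |N w| = |P w|.
    Summing over the rows w = Q y of G, and bounding |N /\ Q y| by s |y| with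
    s = ||n^T Q||_2, yields 0 <= |G|^2 - |G P|^2 <= s^2 |G|^2
    ([tangential_loss]).

    This is where the square in psi comes from: a loss of s^2 |G|^2 on the
    squares is a loss of at most s^2 |G| on the norms, as
    sqrt (1 - s^2) >= 1 - s^2.  So | |G| - |F b^T| | <= psi, and the bound on the
    difference of the squares follows. *)

(** * Frobenius norm *)

Lemma frob_ge0 (R : realType) p q (A : 'M[R]_(p, q)) : 0 <= frob A.
Proof. exact: sqrtr_ge0. Qed.

Lemma sqr_frob (R : realType) p q (A : 'M[R]_(p, q)) :
  frob A ^+ 2 = \sum_(i < p) \sum_(j < q) A i j ^+ 2.
Proof.
by rewrite sqr_sqrtr// sumr_ge0// => i _; rewrite sumr_ge0// => j _; rewrite sqr_ge0.
Qed.

Lemma sqr_frob_trace (R : realType) p q (A : 'M[R]_(p, q)) :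
  frob A ^+ 2 = \tr (A *m A^T).
Proof.
rewrite sqr_frob; apply: eq_bigr => i _; rewrite mxE.
by apply: eq_bigr => j _; rewrite mxE expr2.
Qed.

Lemma frobN (R : realType) p q (A : 'M[R]_(p, q)) : frob (- A) = frob A.
Proof.
apply/eqP; rewrite -(eqrXn2 (n := 2)) ?frob_ge0//.
by rewrite !sqr_frob_trace linearN /= mulmxN mulNmx opprK.
Qed.

Lemma sqr_frobZ (R : realType) p q (c : R) (A : 'M[R]_(p, q)) :
  frob (c *: A) ^+ 2 = c ^+ 2 * frob A ^+ 2.
Proof.
by rewrite !sqr_frob_trace linearZ /= -scalemxAr -scalemxAl scalerA mxtraceZ expr2.
Qed.

Lemma frob_eq0 (R : realType) p q (A : 'M[R]_(p, q)) : frob A = 0 -> A = 0.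
Proof.
move=> A0; have : frob A ^+ 2 = 0 by rewrite A0 expr0n.
rewrite sqr_frob => /eqP; rewrite psumr_eq0; last first.
  by move=> i _; rewrite sumr_ge0// => j _; rewrite sqr_ge0.
move=> /allP H; apply/matrixP => i j; rewrite mxE.
have := H i (mem_index_enum i); rewrite /= psumr_eq0; last by move=> *; rewrite sqr_ge0.
by move=> /allP/(_ j (mem_index_enum j)); rewrite /= sqrf_eq0 => /eqP.
Qed.

Lemma ler_frobD (R : realType) p q (A B : 'M[R]_(p, q)) :
  frob (A + B) <= frob A + frob B.
Proof.
have symT : \tr (B *m A^T) = \tr (A *m B^T).
  by rewrite -[LHS]mxtrace_tr trmx_mul trmxK.
have expand (s t : R) : frob (s *: A + t *: B) ^+ 2 =
    s ^+ 2 * frob A ^+ 2 + 2 * s * t * \tr (A *m B^T) + t ^+ 2 * frob B ^+ 2.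
  rewrite !sqr_frob_trace linearD !linearZ /= mulmxDl !mulmxDr.
  rewrite -!scalemxAr -!scalemxAl !scalerA !linearD !linearZ /= symT.
  ring.
(* Cauchy-Schwarz, from the nonnegativity of the norm of |B| A - |A| B. *)
have CS : \tr (A *m B^T) <= frob A * frob B.
  have [A0|A0] := eqVneq (frob A) 0.
    by rewrite A0 (frob_eq0 A0) !mul0mx mxtrace0 mul0r.
  have [B0|B0] := eqVneq (frob B) 0.
    by rewrite B0 (frob_eq0 B0) trmx0 !mulmx0 mxtrace0 mulr0.
  have AB : 0 < frob A * frob B by rewrite mulr_gt0// lt_def ?A0 ?B0 frob_ge0.
  rewrite -(ler_pM2l AB).
  have := sqr_ge0 (frob (frob B *: A + (- frob A) *: B)); rewrite expand; nra.
have := expand 1 1; rewrite !scale1r => eAB.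
rewrite -(ler_pXn2r (n := 2)) ?nnegrE ?addr_ge0 ?frob_ge0// eAB; nra.
Qed.

(** * The norm of a trivector *)

(** F vanishes unless its three indices are distinct, and distinct indices form
    one of the six rearrangements of an increasing triple; every rearrangement
    is produced by the two adjacent transpositions, under which F is invariant. *)
Lemma sum_increasing_triples (R : realType) m (F : 'I_m -> 'I_m -> 'I_m -> R) :
  (forall a b c, F b a c = F a b c) -> (forall a b c, F a c b = F a b c) ->
  (forall a b, F a a b = 0) ->
  \sum_(a < m) \sum_(b < m) \sum_(c < m) F a b c =
  6 * \sum_(a < m) \sum_(b < m | (a < b)%N) \sum_(c < m | (b < c)%N) F a b c.
Proof.
move=> F12 F23 F0.
have F0' a b : F b a a = 0 by rewrite -F12 F23 F0.
have F0'' a b : F a b a = 0 by rewrite F23 F0.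
pose T (P : nat -> nat -> nat -> bool) :=
  \sum_(a < m) \sum_(b < m) \sum_(c < m) (P a b c)%:R * F a b c.
have T12 P : T (fun a b c => P b a c) = T P.
  rewrite /T exchange_big; do 3 (apply: eq_bigr => ? _); by rewrite F12.
have T23 P : T (fun a b c => P a c b) = T P.
  rewrite /T; apply: eq_bigr => a _.
  rewrite exchange_big; do 2 (apply: eq_bigr => ? _); by rewrite F23.
pose O a b c := (a < b < c)%N.
have TO : T O = \sum_(a < m) \sum_(b < m | (a < b)%N) \sum_(c < m | (b < c)%N) F a b c.
  apply: eq_bigr => a _; rewrite [RHS]big_mkcond; apply: eq_bigr => b _.
  case: ifP => ab; last by rewrite big1// => c _; rewrite /O ab mul0r.
  rewrite [RHS]big_mkcond; apply: eq_bigr => c _.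
  by rewrite /O ab /=; case: ifP; rewrite ?mul1r ?mul0r.
(* Off the diagonals exactly one of the six orderings holds. *)
have -> : \sum_(a < m) \sum_(b < m) \sum_(c < m) F a b c =
    T O + T (fun a b c => O a c b) + T (fun a b c => O b a c) +
    T (fun a b c => O c a b) + T (fun a b c => O b c a) + T (fun a b c => O c b a).
  rewrite /T -!big_split; apply: eq_bigr => a _ /=.
  rewrite -!big_split; apply: eq_bigr => b _ /=.
  rewrite -!big_split; apply: eq_bigr => c _ /=.
  rewrite -!mulrDl -!natrD /O.
  have [->|ab] := eqVneq a b; first by rewrite F0 mulr0.
  have [->|bc] := eqVneq b c; first by rewrite F0' mulr0.
  have [->|ca] := eqVneq c a; first by rewrite F0'' mulr0.
  set k := (X in X%:R * _); suff -> : k = 1%N by rewrite mul1r.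
  rewrite /k; move: ab bc ca; rewrite -!val_eqE /=; case: ltngtP; case: ltngtP; case: ltngtP => //=; lia.
have T1 : T (fun a b c => O a c b) = T O by rewrite (T23 O).
have T2 : T (fun a b c => O b a c) = T O by rewrite (T12 O).
have T3 : T (fun a b c => O c a b) = T O by rewrite (T23 (fun a b c => O b a c)).
have T4 : T (fun a b c => O b c a) = T O by rewrite (T12 (fun a b c => O a c b)).
have T5 : T (fun a b c => O c b a) = T O by rewrite (T12 (fun a b c => O c a b)).
rewrite T1 T2 T3 T4 T5 -TO; ring.
Qed.

(** The square of a coordinate is invariant under permutation of the indices, so
    the sum over increasing triples is a sixth of the sum over all triples.  In
    the full sum the three squares N_ab^2 w_c^2 contribute |N|^2 |w|^2 = 2 |w|^2
    each, and by skewness the three double products contribute -2 |N w|^2 each. *)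
Lemma sqr_trivec_norm_wedge (R : realType) m (N : 'M[R]_m) (w : 'cV[R]_m) :
  N^T = - N -> frob N ^+ 2 = 2 ->
  trivec_norm (ext_wedge N w) ^+ 2 = frob w ^+ 2 - frob (N *m w) ^+ 2.
Proof.
move=> skN N2.
have Nij i j : N j i = - N i j.
  by have := congr1 (fun X : 'M[R]_m => X i j) skN; rewrite !mxE.
pose T (F : 'I_m -> 'I_m -> 'I_m -> R) :=
  \sum_(a < m) \sum_(b < m) \sum_(c < m) F a b c.
have cyc F : T (fun a b c => F b c a) = T F.
  by rewrite /T exchange_big; apply: eq_bigr => b _; rewrite exchange_big.
have TD F G : T (fun a b c => F a b c + G a b c) = T F + T G.
  rewrite /T -big_split; apply: eq_bigr => a _ /=.
  rewrite -big_split; apply: eq_bigr => b _ /=; exact: big_split.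
have TZ k F : T (fun a b c => k * F a b c) = k * T F.
  by rewrite /T !mulr_sumr; do 2 (apply: eq_bigr => ? _; rewrite mulr_sumr).
pose D a b c := N a b ^+ 2 * w c 0 ^+ 2.
pose X a b c := (N a b * w a 0) * (N b c * w c 0).
have TDE : T D = 2 * frob w ^+ 2.
  rewrite -N2 !sqr_frob /T mulr_suml; apply: eq_bigr => a _.
  rewrite mulr_suml; apply: eq_bigr => b _.
  by rewrite mulr_sumr; apply: eq_bigr => c _; rewrite big_ord1.
have TXE : T X = - frob (N *m w) ^+ 2.
  rewrite sqr_frob /T exchange_big -sumrN; apply: eq_bigr => b _.
  rewrite big_ord1 mxE expr2 -mulNr -sumrN mulr_suml; apply: eq_bigr => a _.
  by rewrite mulr_sumr; apply: eq_bigr => c _; rewrite /X -mulNr -Nij.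
have TE : T (fun a b c => ext_wedge N w a b c ^+ 2) =
    6 * (frob w ^+ 2 - frob (N *m w) ^+ 2).
  have -> : T (fun a b c => ext_wedge N w a b c ^+ 2) =
      T (fun a b c => (D a b c + D b c a + D c a b)
                      + 2 * (X a b c + X b c a + X c a b)).
    by do 3 (apply: eq_bigr => ? _); rewrite /ext_wedge /D /X; ring.
  have cyc2 F : T (fun a b c => F c a b) = T F.
    by rewrite (cyc (fun a b c => F b c a)) (cyc F).
  rewrite TD TZ !TD (cyc D) (cyc2 D) (cyc X) (cyc2 X) TDE TXE; ring.
rewrite /T sum_increasing_triples in TE; last first.
- by move=> a b; rewrite /ext_wedge (Nij b a); have := Nij a a; nra.
- by move=> a b c; rewrite /ext_wedge (Nij b c) (Nij a b) (Nij c a); ring.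
- by move=> a b c; rewrite /ext_wedge (Nij b c) (Nij a b) (Nij c a); ring.
rewrite sqr_sqrtr; first by move: TE; lra.
do 3 (rewrite sumr_ge0// => ? _); exact: sqr_ge0.
Qed.

(** * Inverse square roots of 2 x 2 matrices *)

Lemma sum_ord2 (V : nmodType) (F : 'I_2 -> V) : \sum_i F i = F 0 + F 1.
Proof. by rewrite big_ord_recl big_ord1; congr (_ + F _); apply: val_inj. Qed.

Lemma det_mx22 (R : comPzRingType) (M : 'M[R]_2) :
  \det M = M 0 0 * M 1 1 - M 0 1 * M 1 0.
Proof.
rewrite (expand_det_row _ 0) sum_ord2 /cofactor !det_mx11 !mxE /=.
rewrite expr0 expr1 mul1r mulN1r mulrN; congr (_ * M _ _ - _ * M _ _); exact: val_inj.
Qed.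

Lemma mx22P (T : Type) (A B : 'M[T]_2) :
  A 0 0 = B 0 0 -> A 0 1 = B 0 1 -> A 1 0 = B 1 0 -> A 1 1 = B 1 1 -> A = B.
Proof.
move=> e00 e01 e10 e11; apply/matrixP => i j.
have E (k : 'I_2) : k = 0 \/ k = 1.
  by case: k => -[|[|//]] ?; [left|right]; apply: val_inj.
by case: (E i) => ->; case: (E j) => ->.
Qed.

(** By Cayley-Hamilton, with d^2 = det M and t = tr M,
    (M + d)^2 = M^2 + 2 d M + det M = (t + 2 d) M; so (M + d) / sqrt (t + 2 d) is
    a square root. *)
Lemma posdef_sqrt2 (R : realType) (M : 'M[R]_2) :
  posdef M -> exists S, posdef S /\ S *m S = M.
Proof.
move=> [symM posM].
have M10 : M 1 0 = M 0 1 by rewrite -[in RHS]symM mxE.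
have quad (y : 'cV[R]_2) : (y^T *m M *m y) 0 0 =
    M 0 0 * y 0 0 ^+ 2 + 2 * M 0 1 * y 0 0 * y 1 0 + M 1 1 * y 1 0 ^+ 2.
  rewrite mxE sum_ord2 !mxE !sum_ord2 !mxE M10; ring.
have pos (s t : R) : (s != 0) || (t != 0) ->
    0 < M 0 0 * s ^+ 2 + 2 * M 0 1 * s * t + M 1 1 * t ^+ 2.
  move=> st; have := posM (\col_(i < 2) if i == 0 then s else t).
  rewrite quad !mxE /=; apply.
  apply/eqP => /colP y0; move: st.
  by have := y0 0; have := y0 1; rewrite !mxE /= => -> ->; rewrite eqxx.
have a0 : 0 < M 0 0.
  by have := pos 1 0; rewrite oner_eq0 => /(_ isT); rewrite expr1n expr0n /=; lra.
have c0 : 0 < M 1 1.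
  by have := pos 0 1; rewrite oner_eq0 orbT => /(_ isT); rewrite expr1n expr0n /=; lra.
have d0 : 0 < M 0 0 * M 1 1 - M 0 1 ^+ 2.
  (* The form at (- M01, M00) is M00 times the determinant. *)
  rewrite -(pmulr_rgt0 _ a0).
  have := pos (- M 0 1) (M 0 0); rewrite (gt_eqF a0) orbT => /(_ isT); nra.
pose d := Num.sqrt (M 0 0 * M 1 1 - M 0 1 ^+ 2).
have dd : d * d = M 0 0 * M 1 1 - M 0 1 ^+ 2 by rewrite -expr2 sqr_sqrtr// ltW.
have dge0 : 0 <= d by exact: sqrtr_ge0.
pose k := Num.sqrt (M 0 0 + M 1 1 + 2 * d).
have k0 : 0 < k by rewrite sqrtr_gt0; lra.
have kk : k * k = M 0 0 + M 1 1 + 2 * d by rewrite -expr2 sqr_sqrtr//; lra.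
exists (k^-1 *: (M + d%:M)); split; first split.
- by rewrite linearZ /= linearD /= symM tr_scalar_mx.
- move=> y y0; rewrite -scalemxAr -scalemxAl mxE mulr_gt0 ?invr_gt0//.
  rewrite mulmxDr mulmxDl mxE ltr_pwDl ?posM//.
  rewrite mul_mx_scalar -scalemxAl mxE mulr_ge0// mxE sumr_ge0// => i _.
  by rewrite mxE -expr2 sqr_ge0.
rewrite -scalemxAr -scalemxAl scalerA.
have -> : (M + d%:M) *m (M + d%:M) = (k * k) *: M.
  rewrite kk; apply: mx22P; rewrite !mxE !sum_ord2 !mxE /= ?mulr1n ?mulr0n ?M10; nra.
by rewrite scalerA -invfM mulVf ?scale1r// mulf_neq0 ?gt_eqF.
Qed.

(** A Gram matrix gives the quadratic form y |-> |E y|^2, and E is injective. *)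
Lemma gram_posdef (R : realType) m (E : 'M[R]_(m, 2)) :
  \rank E = 2 -> posdef (E^T *m E).
Proof.
move=> rE; split=> [|y y0]; first by rewrite trmx_mul trmxK.
rewrite mulmxA -trmx_mul -mulmxA.
have -> : ((E *m y)^T *m (E *m y)) 0 0 = frob (E *m y) ^+ 2.
  by rewrite sqr_frob_trace mxtrace_mulC /mxtrace big_ord1.
rewrite exprn_gt0// lt_def frob_ge0 andbT; apply: contra y0 => /eqP/frob_eq0.
rewrite -(mulmx0 _ E) => /row_full_inj -> //.
by rewrite /row_full rE.
Qed.

Lemma posdef_unitmx (R : realType) p (S : 'M[R]_p) : posdef S -> S \in unitmx.
Proof.
move=> [_ posS]; rewrite -row_free_unit -kermx_eq0; apply/rowV0P => u /sub_kermxP uS.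
apply/eqP; rewrite -[u]trmxK trmx_eq0; apply/negP => /negP /posS.
by rewrite trmxK uS mul0mx mxE ltxx.
Qed.

Lemma posdef_invmx (R : realType) p (S : 'M[R]_p) : posdef S -> posdef (invmx S).
Proof.
move=> pS; have uS := posdef_unitmx pS; case: pS => symS posS.
split=> [|y y0]; first by rewrite trmx_inv symS.
have -> : y^T *m invmx S *m y = (invmx S *m y)^T *m S *m (invmx S *m y).
  by rewrite trmx_mul trmx_inv symS -!mulmxA (mulKVmx uS).
apply: posS; apply: contra y0 => /eqP Sy; by rewrite -(mulKVmx uS y) Sy mulmx0.
Qed.

Lemma inv_sqrt_mxP (R : realType) (G : 'M[R]_2) : posdef G ->
  posdef (inv_sqrt_mx G) /\ inv_sqrt_mx G *m inv_sqrt_mx G = invmx G.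
Proof.
move=> /posdef_invmx /posdef_sqrt2 [S hS].
exact: (@xgetPex _ 0 [set S | posdef S /\ S *m S = invmx G] (ex_intro _ S hS)).
Qed.

(** With S = (J^T J)^(-1/2), the identity Q Q^T = J S^2 J^T is immediate; and
    Q^T Q = S (J^T J S) is the identity because (J^T J S) S is, a one-sided
    inverse of a square matrix being two-sided. *)
Lemma orthonormalize (R : realType) m (J : 'M[R]_(m, 2)) :
  \rank J = 2 ->
  let Q := J *m inv_sqrt_mx (J^T *m J) in
  Q^T *m Q = 1%:M /\ Q *m Q^T = J *m invmx (J^T *m J) *m J^T.
Proof.
move=> /gram_posdef pG; have [[symS _] SS] := inv_sqrt_mxP pG.
move: (inv_sqrt_mx _) symS SS => S symS SS /=.
rewrite !trmx_mul symS; split; last first.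
  by rewrite mulmxA -SS mulmxA.
rewrite -!mulmxA [J^T *m _]mulmxA; apply: mulmx1C.
by rewrite -(mulmxA _ S S) SS mulmxV// posdef_unitmx.
Qed.

Lemma det_gram_gt0 (R : realType) m (E : 'M[R]_(m, 2)) :
  \rank E = 2 -> 0 < \det (E^T *m E).
Proof.
move=> /gram_posdef pG; have [S [_ SS]] := posdef_sqrt2 pG.
rewrite lt_def -unitfE -unitmxE posdef_unitmx//= -SS det_mulmx -expr2.
exact: sqr_ge0.
Qed.

(** * The unit bivector of a face *)

(** The quarter turn K of R^2.  As u /\ v = E K E^T with E = [u, v], products of
    copies of u /\ v are computed with the 2 x 2 Gram matrix E^T E. *)
Definition rot2 (R : realType) : 'M[R]_2 := delta_mx 0 1 - delta_mx 1 0.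

Lemma ext_prodE (R : realType) m (u v : 'cV[R]_m) :
  ext_prod u v = row_mx u v *m rot2 R *m (row_mx u v)^T.
Proof.
have E0 i : row_mx u v i 0 = u i 0.
  by rewrite -(row_mxEl u v i 0); congr (row_mx u v i _); exact: val_inj.
have E1 i : row_mx u v i 1 = v i 0.
  by rewrite -(row_mxEr u v i 0); congr (row_mx u v i _); exact: val_inj.
move: (row_mx u v) E0 E1 => E E0 E1; apply/matrixP => i j.
rewrite !mxE !big_ord1 sum_ord2 !mxE !sum_ord2 !mxE /= !E0 !E1; ring.
Qed.

(** For K the quarter turn and G symmetric, K G K is minus the adjugate of G. *)
Lemma rot2_gram (R : realType) (G : 'M[R]_2) :
  G^T = G -> rot2 R *m G *m rot2 R *m G = - (\det G)%:M.
Proof.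
move=> symG.
have G10 : G 1 0 = G 0 1 by rewrite -[in RHS]symG mxE.
apply: mx22P; rewrite det_mx22 !(mxE, sum_ord2) /= G10; ring.
Qed.

Lemma area_gram (R : realType) m (a b c : 'cV[R]_m) :
  nondegenerate_triangle a b c ->
  let E := row_mx (a - b) (b - c) in
  2 * area a b c != 0 /\ (2 * area a b c) ^+ 2 = \det (E^T *m E).
Proof.
move=> /det_gram_gt0 d0 E; rewrite /area -/E mulrCA divff ?mulr1 ?pnatr_eq0//.
by rewrite sqr_sqrtr ?(ltW d0)//; split=> //; rewrite gt_eqF// sqrtr_gt0.
Qed.

Lemma face_normal_skew (R : realType) m (a b c : 'cV[R]_m) :
  (face_normal a b c)^T = - face_normal a b c.
Proof. by rewrite linearZ /= linearB /= !trmx_mul !trmxK -scalerN opprB. Qed.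

(** N^2 is minus the projection onto the plane of the face, and N takes its values
    in that plane.  In coordinates N^3 collapses through [rot2_gram], the
    normalisation by 2 A being the square root of the Gram determinant. *)
Lemma face_normal_cube (R : realType) m (a b c : 'cV[R]_m) :
  nondegenerate_triangle a b c ->
  let N := face_normal a b c in N *m N *m N = - N.
Proof.
move=> hV; have [A0 A2] := area_gram hV.
rewrite /= /face_normal ext_prodE -!scalemxAr -!scalemxAl !scalerA.
move: (row_mx _ _) A0 A2 => E; move: (2 * area a b c) => A A0 A2.
have symG : (E^T *m E)^T = E^T *m E by rewrite trmx_mul trmxK.
have -> : E *m rot2 R *m E^T *m (E *m rot2 R *m E^T) *m (E *m rot2 R *m E^T) =
    E *m (rot2 R *m (E^T *m E) *m rot2 R *m (E^T *m E)) *m rot2 R *m E^T.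
  by rewrite !mulmxA.
rewrite rot2_gram// mulmxN !mulNmx mul_mx_scalar -!scalemxAl -A2 scalerN scalerA.
by congr (- (_ *: _)); field.
Qed.

(** A unit bivector has norm sqrt 2 as a matrix: its coordinate on e_a /\ e_b
    appears at (a, b) and, negated, at (b, a). *)
Lemma frob_face_normal (R : realType) m (a b c : 'cV[R]_m) :
  nondegenerate_triangle a b c -> frob (face_normal a b c) ^+ 2 = 2.
Proof.
move=> hV; have [A0 A2] := area_gram hV.
rewrite sqr_frob_trace face_normal_skew mulmxN linearN /=.
rewrite /face_normal ext_prodE -!scalemxAr -!scalemxAl scalerA.
move: (row_mx _ _) A0 A2 => E; move: (2 * area a b c) => A A0 A2.
have symG : (E^T *m E)^T = E^T *m E by rewrite trmx_mul trmxK.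
have -> : E *m rot2 R *m E^T *m (E *m rot2 R *m E^T) =
    E *m (rot2 R *m E^T *m E *m rot2 R *m E^T) by rewrite !mulmxA.
rewrite mxtraceZ mxtrace_mulC.
have -> : rot2 R *m E^T *m E *m rot2 R *m E^T *m E =
    rot2 R *m (E^T *m E) *m rot2 R *m (E^T *m E) by rewrite !mulmxA.
by rewrite rot2_gram// linearN /= mxtrace_scalar -A2; field.
Qed.

Lemma col3_mul_tr (R : realType) p q (a b c : 'cV[R]_p) (a' b' c' : 'cV[R]_q) :
  col3 a b c *m (col3 a' b' c')^T = a *m a'^T + (b *m b'^T + c *m c'^T).
Proof.
have -> : (col3 a' b' c')^T = col_mx a'^T (col_mx b'^T c'^T).
  by rewrite -tr_row_mx; exact: (@tr_row_mx R q 1 (1 + 1) a' (row_mx b' c')).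
by rewrite -mul_row_col; exact: (@mul_row_col R p 1 (1 + 1) q a (row_mx b c)).
Qed.

Lemma add_col3 (R : realType) p (a b c a' b' c' : 'cV[R]_p) :
  col3 a b c + col3 a' b' c' = col3 (a + a') (b + b') (c + c').
Proof.
rewrite /col3 -[row_mx (b + b') _]add_row_mx.
exact: (@add_row_mx R p 1 (1 + 1) a (row_mx b c) a').
Qed.

(** An affine map is recovered from its vertex values, up to projection of its
    linear part on the plane of the face.  With u = v_i - v_j and v = v_j - v_k
    the three terms reduce to
    (G u (N v)^T - G v (N u)^T) / 2A = G (u v^T - v u^T) N^T / 2A = G N N^T. *)
Lemma bary_mx_reconstruction (R : realType) m (vi vj vk : 'cV[R]_m) n
    (G : 'M[R]_(n, m)) (c : 'cV[R]_n) :
  let N := face_normal vi vj vk in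
  col3 (c + G *m vi) (c + G *m vj) (c + G *m vk) *m (bary_mx vi vj vk)^T =
  G *m (N *m N^T).
Proof.
move=> N; rewrite /bary_mx col3_mul_tr -/N /cross_bivec.
set A := 2 * area vi vj vk.
set u := vi - vj; set v := vj - vk.
have -> : vk - vi = - (u + v) by rewrite /u /v addrA subrK opprB.
have -> : vi = vj + u by rewrite /u addrC subrK.
have -> : vk = vj - v by rewrite /v opprB addrC subrK.
have NE : N = A^-1 *: ext_prod u v by []; clearbody N u v.
have -> : G *m (N *m N^T) =
    A^-1 *: (G *m u *m (N *m v)^T) - A^-1 *: (G *m v *m (N *m u)^T).
  rewrite {1}NE /ext_prod -scalerBr -scalemxAl -scalemxAr; congr (_ *: _).
  by rewrite mulmxBl mulmxBr !trmx_mul !mulmxA.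
rewrite mulmxN !mulmxDr mulmxN !addrA.
move: (G *m u) (G *m v) (N *m u) (N *m v) (c + G *m vj) A^-1 => p q s t d k.
apply/matrixP => i j; rewrite !mxE !big_ord1 !mxE; ring.
Qed.

(** * The part of the tangent vectors normal to the face *)

(** Homogeneity extends the bound on unit vectors, provided the supremum defining
    the operator norm is over a bounded set; by [sqr_trivec_norm_wedge],
    |N /\ Q z| <= |Q z| = |z| = 1. *)
Lemma normal_norm_bound (R : realType) m (N : 'M[R]_m) (Q : 'M[R]_(m, 2)) :
  N^T = - N -> frob N ^+ 2 = 2 -> Q^T *m Q = 1%:M ->
  forall y : 'cV[R]_2,
    trivec_norm (ext_wedge N (Q *m y)) ^+ 2 <= normal_norm N Q ^+ 2 * frob y ^+ 2.
Proof.
move=> skN N2 QQ y.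
have frobQ z : frob (Q *m z : 'cV_m) ^+ 2 = frob (z : 'cV_2) ^+ 2.
  rewrite !sqr_frob_trace -[LHS]mxtrace_mulC -[RHS]mxtrace_mulC trmx_mul.
  by rewrite -mulmxA [Q^T *m _]mulmxA QQ mul1mx.
have wedgeZ k z : trivec_norm (ext_wedge N (Q *m (k *: z))) ^+ 2 =
    k ^+ 2 * trivec_norm (ext_wedge N (Q *m z)) ^+ 2.
  by rewrite !sqr_trivec_norm_wedge// -!scalemxAr !sqr_frobZ mulrBr.
have le_normal z : frob z = 1 ->
    trivec_norm (ext_wedge N (Q *m z)) <= normal_norm N Q.
  move=> z1; apply: ub_le_sup; last by exists z.
  exists 1 => _ [t /= t1 <-].
  rewrite -(ler_pXn2r (n := 2)) ?nnegrE ?sqrtr_ge0// sqr_trivec_norm_wedge//.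
  by rewrite frobQ t1 gerBl sqr_ge0.
have [y0|y0] := eqVneq (frob y) 0.
  by rewrite (frob_eq0 y0) -(scale0r 0) wedgeZ expr0n mul0r mulr_ge0 ?sqr_ge0.
have -> : y = frob y *: ((frob y)^-1 *: y) by rewrite scalerA divff ?scale1r.
have z1 : frob ((frob y)^-1 *: y) = 1.
  apply/eqP; rewrite -(eqrXn2 (n := 2)) ?frob_ge0 ?ler01//.
  by rewrite sqr_frobZ -exprMn mulVf ?expr1n.
rewrite wedgeZ sqr_frobZ z1 expr1n mulr1 mulrC ler_wpM2r ?sqr_ge0//.
by rewrite ler_pXn2r ?nnegrE ?sqrtr_ge0 ?le_normal// (le_trans _ (le_normal _ z1))// sqrtr_ge0.
Qed.

(** Each row of G is the tangent vector Q y, with y the corresponding row of G Q;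
    the loss is the sum of the |N /\ Q y|^2. *)
Lemma tangential_loss (R : realType) m n (N : 'M[R]_m) (Q : 'M[R]_(m, 2))
    (G : 'M[R]_(n, m)) :
  N^T = - N -> frob N ^+ 2 = 2 -> Q^T *m Q = 1%:M -> G *m (Q *m Q^T) = G ->
  0 <= frob G ^+ 2 - frob (G *m N) ^+ 2 <= normal_norm N Q ^+ 2 * frob G ^+ 2.
Proof.
move=> skN N2 QQ GQ.
have rowsum p q (M : 'M[R]_(p, q)) : frob M ^+ 2 = \sum_i frob ((row i M)^T) ^+ 2.
  rewrite sqr_frob; apply: eq_bigr => i _; rewrite sqr_frob.
  by apply: eq_bigr => j _; rewrite big_ord1 !mxE.
pose y i := (row i (G *m Q))^T.
have rowG i : (row i G)^T = Q *m y i.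
  by rewrite /y -[in LHS]GQ mulmxA !row_mul !trmx_mul trmxK mulmxA.
have rowGN i : frob ((row i (G *m N))^T) = frob (N *m (Q *m y i)).
  by rewrite row_mul trmx_mul skN mulNmx frobN rowG.
have -> : frob G ^+ 2 - frob (G *m N) ^+ 2 =
    \sum_i trivec_norm (ext_wedge N (Q *m y i)) ^+ 2.
  rewrite (rowsum _ _ G) (rowsum _ _ (G *m N)) -sumrB; apply: eq_bigr => i _.
  by rewrite rowGN rowG sqr_trivec_norm_wedge.
rewrite sumr_ge0 => [/=|i _]; last exact: sqr_ge0.
have -> : frob G ^+ 2 = frob (G *m Q) ^+ 2.
  by rewrite -[in LHS]GQ mulmxA !sqr_frob_trace trmx_mul trmxK !mulmxA
    -(mulmxA _ Q^T Q) QQ mulmx1.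
rewrite (rowsum _ _ (G *m Q)) mulr_sumr; apply: ler_sum => i _.
exact: normal_norm_bound.
Qed.

(** * Comparison of the norms *)

(** Only s < 1 has content; there it amounts to sqrt (1 - s) >= 1 - s. *)
Lemma le_of_sqr_loss (R : realType) (a p s : R) :
  0 <= a -> 0 <= p -> 0 <= s -> a ^+ 2 - p ^+ 2 <= s * a ^+ 2 ->
  a <= p + a * s.
Proof.
move=> a0 p0 s0 loss; have [s1|s1] := leP 1 s; first by nra.
have {}s1 : 0 <= 1 - s by lra.
suff : a * (1 - s) <= p by lra.
rewrite -(ler_pXn2r (n := 2)) ?nnegrE ?mulr_ge0//.
have : 0 <= a ^+ 2 * ((1 - s) * s) by rewrite !mulr_ge0 ?sqr_ge0.
nra.
Qed.

Lemma dist_sqr_le (R : realType) (a c t : R) :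
  0 <= a -> 0 <= c -> 0 <= t -> a <= c + t -> c <= a + t ->
  `|a ^+ 2 - c ^+ 2| <= t ^+ 2 + 2 * c * t.
Proof. by move=> a0 c0 t0 ac ca; rewrite ler_norml; apply/andP; split; nra. Qed.

Theorem theorem3p2 (R : realType) (m n : nat) (hm : (2 <= m)%N) (hn : (1 <= n)%N)
    (Omega : set 'cV[R]_2) (x : 'cV[R]_2 -> 'cV[R]_m)
    (hM : smooth_simple_surface Omega x)
    (wi wj wk : 'cV[R]_2)
    (hsub : triangle wi wj wk `<=` Omega)
    (hW : nondegenerate_triangle wi wj wk)
    (hV : nondegenerate_triangle (x wi) (x wj) (x wk))
    (f : 'cV[R]_m -> 'cV[R]_n)
    (hf : C1_on Omega (f \o x))
    (w : 'cV[R]_2) (hw : triangle wi wj wk w) :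
  let b := bary_mx (x wi) (x wj) (x wk) in
  let F := col3 (f (x wi)) (f (x wj)) (f (x wk)) in
  let psi_w := psi Omega x f (x wi) (x wj) (x wk) w in
  `| frob (tgrad Omega x f w) ^+ 2 - frob (F *m b^T) ^+ 2 |
    <= psi_w ^+ 2 + 2 * frob (F *m b^T) * psi_w.
Proof.
have [_ _ /(_ w (hsub _ hw)) rankJ] := hM.
have [QQ QQT] := orthonormalize rankJ.
rewrite -/(tangent_basis Omega x w) in QQ QQT.
have GQ : tgrad Omega x f w *m (tangent_basis Omega x w *m (tangent_basis Omega x w)^T)
    = tgrad Omega x f w.
  rewrite QQT /tgrad -!mulmxA; congr (_ *m _).
  rewrite !mulmxA -(mulmxA (invmx _)) mulVmx ?mul1mx//.
  exact: posdef_unitmx (gram_posdef rankJ).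
lazy zeta; rewrite /psi; set b := bary_mx _ _ _; set F := col3 (f _) _ _.
set N := face_normal _ _ _; set Q := tangent_basis _ _ _ in QQ GQ *.
set G := tgrad _ _ _ _ in GQ *; set h := tangent_remainder _ _ _ _.
set H := col3 _ _ _.
have skN : N^T = - N := face_normal_skew _ _ _.
have /andP[loss0 loss] := tangential_loss skN (frob_face_normal hV) QQ GQ.
(* (N N^T)^2 = N N^T, by the cube identity. *)
have frobGP : frob (G *m (N *m N^T)) = frob (G *m N).
  apply/eqP; rewrite -(eqrXn2 (n := 2)) ?frob_ge0// !sqr_frob_trace !trmx_mul trmxK skN.
  rewrite !(mulmxN, mulNmx, opprK) !mulmxA.
  have -> : G *m N *m N *m N *m N = G *m (N *m N *m N) *m N by rewrite !mulmxA.
  by rewrite (face_normal_cube hV) mulmxN !mulNmx.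
(* The affine map c + G v with c = f(x) - G x sends v_l to f(v_l) - h_l. *)
have FE : F *m b^T = H *m b^T + G *m (N *m N^T).
  rewrite -(bary_mx_reconstruction _ _ _ _ (f (x w) - G *m x w)) -mulmxDl.
  congr (_ *m _); rewrite /H add_col3 /h /tangent_remainder -/G.
  have cancel v : f v = f v - f (x w) + G *m (x w - v) + (f (x w) - G *m x w + G *m v).
    by rewrite mulmxBr; apply/matrixP => i j; rewrite !mxE; ring.
  by congr col3; exact: cancel.
have c_le : frob (F *m b^T) <= frob (H *m b^T) + frob (G *m N).
  by rewrite -frobGP FE ler_frobD.
have p_le : frob (G *m N) <= frob (F *m b^T) + frob (H *m b^T).
  rewrite -frobGP -(frobN (H *m b^T)) (le_trans _ (ler_frobD _ _))//.
  by rewrite FE addrAC subrr add0r.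
have g_le := le_of_sqr_loss (frob_ge0 G) (frob_ge0 _) (sqr_ge0 _) loss.
have p_le_g : frob (G *m N) <= frob G.
  by rewrite -(ler_pXn2r (n := 2)) ?nnegrE ?frob_ge0// -subr_ge0.
have gs0 : 0 <= frob G * normal_norm N Q ^+ 2 by rewrite mulr_ge0 ?frob_ge0 ?sqr_ge0.
have e0 := frob_ge0 (H *m b^T).
by apply: dist_sqr_le; rewrite ?frob_ge0 ?addr_ge0//; lra.
Qed.
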